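(* Let $\langle\mathbf{A},m\rangle$ be a monotone semilattice, $\langle X,\mathcal{K},R\rangle$ an $mS$-space, and $T\subseteq X\times X(\mathbf{A})$ a one-to-one monotone meet-relation from $\langle X,\mathcal{K},R\rangle$ to $\langle X(\mathbf{A}),\mathcal{K}_\mathbf{A},R_m\rangle$. Then $\mathcal{F}_T=\{T(x)\colon x\in X\}$ is a monotone lower-Vietoris-type family of $\langle X(\mathbf{A}),\mathcal{K}_\mathbf{A},R_m\rangle$.
   Context: A monotone semilattice is a meet-semilattice with top $\mathbf{A}$ with an order-preserving $m\colon A\to A$. A proper filter is irreducible if not the intersection of two filters both different from it; $X(\mathbf{A})$ is the set of irreducible filters; $\beta(a)=\{P\colon a\in P\}$; $\mathcal{K}_\mathbf{A}=\{\beta(a)^c\colon a\in A\}$. For a space $\langle X,\mathcal{K}\rangle$ with subbase $\mathcal{K}$: $S(X)=\{U^c\colon U\in\mathcal{K}\}$; $C_\mathcal{K}(X)$ = intersections of subfamilies of $S(X)$; $\mathcal{Z}(X)$ = sets $\bigcap\mathcal{L}$ with $\mathcal{L}\subseteq\mathcal{K}$ dually directed. $I_\mathbf{A}(Z)=\{a\colon\beta(a)\cap Z=\emptyset\}$; $R_m\subseteq X(\mathbf{A})\times\mathcal{Z}(X(\mathbf{A}))$, $(P,Z)\in R_m$ iff $m^{-1}[P]\cap I_\mathbf{A}(Z)=\emptyset$. An $S$-space is $\langle X,\mathcal{K}\rangle$ with: (S1) $T_0$, $X=\bigcup\mathcal{K}$; (S2) $\mathcal{K}$ consists of compact opens, closed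 under finite unions, $\emptyset\in\mathcal{K}$; (S3) for $U,V\in\mathcal{K}$, $x\in U\cap V$, there are $W,D\in\mathcal{K}$ with $x\notin W$, $x\in D$, $D\subseteq(U\cap V)\cup W$; (S4) if $Y\in C_\mathcal{K}(X)$ and $\mathcal{J}\subseteq S(X)$ is a $Y$-family (for $A,B\in\mathcal{J}$ there are $H\in S(X)$, $C\in\mathcal{J}$, $Y\subseteq H$, $A\cap H\subseteq C$, $B\cap H\subseteq C$) with $Y\cap A^c\ne\emptyset$ for all $A\in\mathcal{J}$, then $Y\cap\bigcap_{A\in\mathcal{J}}A^c\ne\emptyset$. $L_U=\{Z\in\mathcal{Z}(X)\colon Z\cap U\ne\emptyset\}$. An $mS$-space is $\langle X,\mathcal{K},R\rangle$, $\langle X,\mathcal{K}\rangle$ an $S$-space, $R\subseteq X\times\mathcal{Z}(X)$, with $m_R(U)=\{x\colon\forall Z\in R(x)[Z\cap U\neq\emptyset]\}\in S(X)$ for $U\in S(X)$ and $R(x)=\bigcap\{L_U\colon U\in S(X),x\in m_R(U)\}$. A meet-relation between $S$-spaces is $T\subseteq X_1\times X_2$ with $\Box_T(U)=\{x\colon T(x)\subseteq U\}\in S(X_1)$ for $U\in S(X_2)$ and $T(x)=\bigcap\{U\in S(X_2)\colon T(x)\subseteq U\}$; it is monotone (between $mS$-spaces) if $m_{R_1}\circ\Box_T=\Box_T\circ m_{R_2}$; it is one-to-one if for $x\in X_1$, $U\in S(X_1)$, $x\notin U$, there is $V\in S(X_2)$ with $U\subseteq\Box_T(V)$, $x\notin\Box_T(V)$.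 For a family $\mathcal{F}$ and a set $U$, $U^-_\mathcal{F}=\{Y\in\mathcal{F}\colon Y\cap U\ne\emptyset\}$, $\mathcal{M}_\mathcal{F}=\{U^-_\mathcal{F}\colon U\in\mathcal{K}_\mathbf{A}\}$. For $H\subseteq\mathcal{Z}(X(\mathbf{A}))$, $H$ is $\mathcal{M}_\mathcal{F}$-increasing if $\{V\in\mathcal{K}_\mathbf{A}\colon\exists U\in H\cap\mathcal{K}_\mathbf{A}[U^-_\mathcal{F}\subseteq V^-_\mathcal{F}]\}=H\cap\mathcal{K}_\mathbf{A}$. A monotone lower-Vietoris-type family of $\langle X(\mathbf{A}),\mathcal{K}_\mathbf{A},R_m\rangle$ is a family $\mathcal{F}$ of nonempty sets in $C_{\mathcal{K}_\mathbf{A}}(X(\mathbf{A}))$ with $\langle\mathcal{F},\mathcal{M}_\mathcal{F}\rangle$ an $S$-space and $R_m[Y]=\{Z\colon\exists y\in Y\,(y,Z)\in R_m\}$ $\mathcal{M}_\mathcal{F}$-increasing for every $Y\in\mathcal{F}$. *)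

(* Defs.v *)
From HB Require Import structures.
From mathcomp Require Import all_boot all_order.
From mathcomp Require Import boolp classical_sets topology.

Set Implicit Arguments.
Unset Strict Implicit.
Unset Printing Implicit Defensive.

Local Open Scope classical_set_scope.

(** A copy of [X] carrying the topology that has [K] as a subbase. *)
Definition subbase_space (X : choiceType) (K : set (set X)) : Type := X.

HB.instance Definition _ (X : choiceType) (K : set (set X)) :=
  Choice.on (subbase_space K).
HB.instance Definition _ (X : choiceType) (K : set (set X)) :=
  isSubBaseTopological.Build (subbase_space K) K id.

Section Spaces.
Variables (X : choiceType) (K : set (set X)).

Definition Sfam : set (set X) := [set ~` U | U in K].

(** For the empty subfamily the intersection is the whole of [X]. *)
Definition CK : set (set X) :=
  [set \bigcap_(U in L) U | L in [set L | L `<=` Sfam]].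

(** Directed families are nonempty, as usual. *)
Definition dually_directed (L : set (set X)) :=
  L !=set0 /\
  forall U V, L U -> L V -> exists2 W, L W & W `<=` U /\ W `<=` V.

Definition Zfam : set (set X) :=
  [set \bigcap_(U in L) U | L in [set L | L `<=` K /\ dually_directed L]].

(** Nonemptiness matters: [set0] belongs to [CK] as soon as [K] covers [X], so
    an empty [J] would make the separation axiom [S4] below unsatisfiable. *)
Definition Yfamily (Y : set X) (J : set (set X)) :=
  [/\ J !=set0, J `<=` Sfam &
      forall A B, J A -> J B -> exists H C,
        [/\ Sfam H, J C, Y `<=` H, A `&` H `<=` C & B `&` H `<=` C]].

Record S_space : Prop := {
  S1_T0 : kolmogorov_space (subbase_space K);
  S1_cover : \bigcup_(U in K) U = setT;
  S2_open : forall U, K U -> open (U : set (subbase_space K));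
  S2_compact : forall U, K U -> compact (U : set (subbase_space K));
  S2_setU : forall U V, K U -> K V -> K (U `|` V);
  S2_set0 : K set0;
  S3 : forall U V x, K U -> K V -> (U `&` V) x ->
    exists W D, [/\ K W, K D, ~ W x, D x & D `<=` (U `&` V) `|` W];
  S4 : forall Y J, CK Y -> Yfamily Y J ->
    (forall A, J A -> Y `&` ~` A !=set0) ->
    Y `&` \bigcap_(A in J) ~` A !=set0
}.

Definition Lset (U : set X) : set (set X) :=
  [set Z | Zfam Z /\ Z `&` U !=set0].

(** A relation [R] between [X] and the sets in [Zfam] is given by its sections
    [R x]. *)
Definition mR (R : X -> set (set X)) (U : set X) : set X :=
  [set x | forall Z, R x Z -> Z `&` U !=set0].

(** In [mS_section] the intersection is taken inside [Zfam], which only matters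
    when no [U] in [Sfam] satisfies [mR R U x]. *)
Record mS_space (R : X -> set (set X)) : Prop := {
  mS_S_space : S_space;
  mS_sub : forall x, R x `<=` Zfam;
  mS_mR : forall U, Sfam U -> Sfam (mR R U);
  mS_section : forall x,
    R x = Zfam `&` \bigcap_(U in [set U | Sfam U /\ mR R U x]) Lset U
}.

End Spaces.

Section MeetRelations.
Variables (X1 X2 : choiceType) (K1 : set (set X1)) (K2 : set (set X2)).

Definition boxT (T : X1 -> set X2) (U : set X2) : set X1 :=
  [set x | T x `<=` U].

Record meet_relation (T : X1 -> set X2) : Prop := {
  meet_rel_box : forall U, Sfam K2 U -> Sfam K1 (boxT T U);
  meet_rel_section : forall x,
    T x = \bigcap_(U in [set U | Sfam K2 U /\ T x `<=` U]) U
}.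

Definition monotone_meet_relation (R1 : X1 -> set (set X1))
    (R2 : X2 -> set (set X2)) (T : X1 -> set X2) :=
  meet_relation T /\
  forall U, Sfam K2 U -> mR R1 (boxT T U) = boxT T (mR R2 U).

Definition one_to_one (T : X1 -> set X2) :=
  forall x U, Sfam K1 U -> ~ U x ->
    exists V, [/\ Sfam K2 V, U `<=` boxT T V & ~ boxT T V x].

End MeetRelations.

Section LowerVietoris.
Variables (X : choiceType) (K : set (set X)) (R : X -> set (set X)).
Variable F : set (set X).

Definition hit (U : set X) : set F := [set Y : F | val Y `&` U !=set0].

Definition MF : set (set F) := [set hit U | U in K].

Definition MF_increasing (H : set (set X)) :=
  [set V | K V /\ exists2 U, (H `&` K) U & hit U `<=` hit V] = H `&` K.

Record monotone_lower_Vietoris : Prop := {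
  mlV_nonempty : forall Y, F Y -> Y !=set0;
  mlV_CK : F `<=` CK K;
  mlV_S_space : S_space MF;
  mlV_increasing : forall Y, F Y -> MF_increasing (\bigcup_(y in Y) R y)
}.

End LowerVietoris.

Section Semilattices.
Context {d : Order.disp_t} {A : tMeetSemilatticeType d}.

Record slat_filter (F : set A) : Prop := {
  slat_filter_top : F \top%O;
  slat_filter_up : forall a b, (a <= b)%O -> F a -> F b;
  slat_filter_meet : forall a b, F a -> F b -> F (Order.meet a b)
}.

Definition irreducible_filter (P : set A) :=
  [/\ slat_filter P, P <> setT &
      ~ exists F1 F2, [/\ slat_filter F1, slat_filter F2,
                          F1 <> P, F2 <> P & P = F1 `&` F2]].

End Semilattices.

Definition XA {d : Order.disp_t} (A : tMeetSemilatticeType d) : choiceType :=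
  [set P : set A | irreducible_filter P].

Section Dual.
Context {d : Order.disp_t} {A : tMeetSemilatticeType d}.

Definition beta (a : A) : set (XA A) := [set P | val P a].

Definition IA (Z : set (XA A)) : set A := [set a | beta a `&` Z = set0].

End Dual.

Definition KA {d : Order.disp_t} (A : tMeetSemilatticeType d) :
  set (set (XA A)) := [set ~` beta a | a in setT].
Arguments KA {d} A.

Definition Rm {d : Order.disp_t} {A : tMeetSemilatticeType d} (m : A -> A)
    (P : XA A) : set (set (XA A)) :=
  [set Z | Zfam (KA A) Z /\ (m @^-1` val P) `&` IA Z = set0].

(* Main.v *)
Require Import Defs.
From mathcomp Require Import all_boot all_order.
From mathcomp Require Import boolp classical_sets topology.

Import Order.LTheory.

Local Open Scope classical_set_scope.

(** The map [x |-> T x] is a bijection from [X] onto the family [{T x}]: it is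
    injective because one-to-oneness of [T] makes [T x] determine the members of
    the subbase that contain [x], and the space is T0.  The trace of a subbasic
    set [hit (~` beta a)] along it is [~` boxT T (beta a)], and compactness shows
    that every member of [K] has this form; so the S-space structure of [X] is
    transported to the family.  For the monotonicity condition, [beta (m a)] is
    [mR (Rm m) (beta a)], hence [boxT T (beta (m a)) = mR R (boxT T (beta a))] is
    monotone in [boxT T (beta a)]. *)

(** * Topologies generated by a subbase, and compactness *)

Section Subbase.

Lemma subbase_open (X : choiceType) (K : set (set X)) (U : set X) :
  K U -> open (U : set (subbase_space K)).
Proof.
move=> KU; exists [set U]; last by rewrite bigcup_set1.
by move=> _ ->; exact: (@finI_from1 _ _ K id U).
Qed.

Lemma subbase_continuous (X : topologicalType) (Y : choiceType)
    (K : set (set Y)) (f : X -> subbase_space K) :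
  (forall V : set Y, K V -> open (f @^-1` V)) -> continuous f.
Proof.
move=> fop; apply/continuousP => _ [D sD <-].
rewrite preimage_bigcup; apply: bigcup_open => V /sD [E sE <-].
rewrite preimage_bigcap bigcap_fset.
rewrite big_seq; elim/big_ind: _ => [|A B|i iE]; first exact: openT.
- exact: openI.
- by apply: fop; apply: set_mem; exact: sE.
Qed.

(** An open set is a union of finite intersections of members of [K]; the intersection that contains
    [x] inside [A] misses [y], so one of its factors does. *)
Lemma subbase_nbhs_separated (X : choiceType) (K : set (set X))
    (x y : subbase_space K) (A : set (subbase_space K)) :
  nbhs x A -> ~ A y -> exists U : set X, [/\ K U, U x & ~ U y].
Proof.
rewrite nbhsE => -[B [[D sD <-] [V DV Vx]] BA] nAy.
have [E sE VE] := sD _ DV.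
have nVy : ~ V y by move=> Vy; apply: nAy; apply: BA; exists V.
move: Vx nVy; rewrite -VE => Vx /existsNP[U /not_implyP[EU nUy]].
by exists U; split=> //; [apply: set_mem; exact: sE | exact: Vx].
Qed.

Lemma kolmogorov_subbase_separated (X : choiceType) (K : set (set X))
    (x y : X) :
  kolmogorov_space (subbase_space K) -> (forall U, K U -> U x <-> U y) -> x = y.
Proof.
move=> T0 xyK; apply/eqP; apply: contrapT => /negP /T0 [A].
case=> -[/set_mem nA /set_mem nAy];
  have [U [KU U1]] := @subbase_nbhs_separated _ _ _ _ _ nA nAy; case;
  by apply/(xyK U KU).
Qed.

(** If no single [O i] covered [W], the differences of [W] and [O i] would generate a proper filter,
    by directedness. It would cluster at a point of [W], yet some [O i] is a neighbourhood of that
    point. *)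
Lemma compact_directed_cover (X : topologicalType) (I : Type) (E : set I)
    (O : I -> set X) (W : set X) :
  compact W -> E !=set0 ->
  (forall i j, E i -> E j -> exists2 k, E k & O i `|` O j `<=` O k) ->
  (forall i, E i -> open (O i)) -> W `<=` \bigcup_(i in E) O i ->
  exists2 i, E i & W `<=` O i.
Proof.
move=> cW [i0 Ei0] dirO opO covO; apply: contrapT => noi.
pose F := filter_from E (fun i => W `\` O i).
have PF : ProperFilter F.
  apply: filter_from_proper.
    apply: filter_from_filter; first by exists i0.
    move=> i j Ei Ej; have [k Ek sk] := dirO _ _ Ei Ej; exists k => //.
    by move=> x [Wx nkx]; split; split=> // Ox; apply/nkx/sk; [left|right].
  move=> i Ei; apply: contrapT => WO0; apply: noi; exists i => // x Wx.
  by apply: contrapT => nOx; apply: WO0; exists x.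
have FW : F W by exists i0 => // x [].
have [x [Wx clx]] := cW F PF FW.
have [i Ei Oix] := covO _ Wx.
have [||y [[_ nOy] Oy]] := clx (W `\` O i) (O i); last exact: nOy.
- by exists i.
- exact: open_nbhs_nbhs (conj (opO _ Ei) Oix).
Qed.

End Subbase.

(** * Transport of S-spaces along a bijection *)

Section Transport.
Variables (X Y : choiceType) (KX : set (set X)) (KY : set (set Y)).
Variables (f : X -> Y) (g : Y -> X).
Hypotheses (fK : cancel f g) (gK : cancel g f).
Hypothesis KE : forall V, KY V <-> KX (f @^-1` V).

Let preimageK U : f @^-1` (g @^-1` U) = U.
Proof. by apply/seteqP; split => x; rewrite /preimage /= fK. Qed.

Let preimageK' V : g @^-1` (f @^-1` V) = V.
Proof. by apply/seteqP; split => x; rewrite /preimage /= gK. Qed.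

Let KXE U : KX U <-> KY (g @^-1` U).
Proof. by rewrite KE preimageK. Qed.

Let SfamE V : Sfam KY V <-> Sfam KX (f @^-1` V).
Proof.
split=> [[W KW <-]|[U KU UV]].
  by exists (f @^-1` W); [exact/KE | rewrite preimage_setC].
exists (g @^-1` U); first exact/KXE.
by rewrite preimage_setC UV preimageK'.
Qed.

(** As [f] matches the two subbases, [f] and [g] are continuous, which carries over T0 and
    compactness; the data of S3 and S4 are pulled back along [f]. *)
Lemma S_space_transport : S_space KX -> S_space KY.
Proof.
move=> SX.
have fcont : continuous (f : subbase_space KX -> subbase_space KY).
  by apply: subbase_continuous => V /KE; exact: S2_open.
have gcont : continuous (g : subbase_space KY -> subbase_space KX).
  by apply: subbase_continuous => U /KXE; exact: subbase_open.
split.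
- move=> x y xy.
  have gxy : g x != g y by rewrite (can_eq gK).
  have [A [|] [/set_mem nA /set_mem nAy]] := S1_T0 SX gxy;
    exists (g @^-1` A); [left|right]; split; apply: mem_set => //;
    exact: gcont nA.
- apply/seteqP; split=> // y _.
  have : (\bigcup_(U in KX) U) (g y) by rewrite (S1_cover SX).
  by case=> U KU Uy; exists (g @^-1` U) => //; exact/KXE.
- exact: subbase_open.
- move=> V /KE KV.
  have -> : V = f @` (f @^-1` V).
    apply/seteqP; split=> [y Vy|_ [x Vx <-]//].
    by exists (g y); rewrite /preimage /= gK.
  apply: (@continuous_compact (subbase_space KX) (subbase_space KY)).
    exact: continuous_subspaceT.
  exact: S2_compact.
- by move=> U V /KE KU /KE KV; apply/KE; rewrite preimage_setU; exact: S2_setU.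
- by apply/KE; rewrite preimage_set0; exact: S2_set0.
- move=> U V y /KE KU /KE KV UVy.
  have UVx : (f @^-1` U `&` f @^-1` V) (g y) by rewrite /preimage /setI /= gK.
  have [W [D [KW KD Wy Dy DW]]] := S3 SX KU KV UVx.
  exists (g @^-1` W), (g @^-1` D); split=> //; [exact/KXE|exact/KXE|].
  by move=> z /DW; rewrite /preimage /setI /setU /= gK.
- move=> B J [L LS <-] [[A0 JA0] JS Jdir] JB; set B' := \bigcap_(U in L) U.
  have CB : CK KX (f @^-1` B').
    exists [set f @^-1` V | V in L]; first by move=> _ [V /LS/SfamE ? <-].
    by rewrite bigcap_image preimage_bigcap.
  have YJ : Yfamily KX (f @^-1` B') [set f @^-1` V | V in J].
    split; first by exists (f @^-1` A0); exists A0.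
      by move=> _ [V /JS/SfamE ? <-].
    move=> _ _ [A JA <-] [A' JA' <-].
    have [H [C [SH JC BH AC AC']]] := Jdir _ _ JA JA'.
    exists (f @^-1` H), (f @^-1` C); split; first exact/SfamE.
    + by exists C.
    + by move=> x /BH.
    + by move=> x /AC.
    + by move=> x /AC'.
  have [|x [Bx Jx]] := S4 SX CB YJ.
    move=> _ [A JA <-]; have [y [By nAy]] := JB _ JA.
    by exists (g y); rewrite /preimage /setI /setC /= gK.
  by exists (f x); split=> // A JA; apply: (Jx (f @^-1` A)); exists A.
Qed.

End Transport.

(** * Irreducible filters and the relation [Rm] *)

Section Filters.
Context {d : Order.disp_t} {A : tMeetSemilatticeType d}.
Implicit Types a b c : A.

Lemma slat_filter_principal c : slat_filter [set x | (c <= x)%O].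
Proof.
split=> [|a b ab ca|a b ca cb]; first exact: lex1.
- exact: le_trans ca ab.
- by rewrite /= lexI ca cb.
Qed.

(** Zorn gives a filter [P] maximal among those that contain [c] and miss [a]. Every filter properly
    above [P] contains [a], so [P] is not the intersection of two of them. *)
Lemma irreducible_filter_separation a c : ~ (c <= a)%O ->
  exists P : set A, [/\ irreducible_filter P, P c & ~ P a].
Proof.
move=> nca; pose C := [set x | (c <= x)%O].
(* [set0] is admitted so that the empty chain has an upper bound. *)
pose good (G : set A) := G = set0 \/ [/\ slat_filter G, G c & ~ G a].
have goodC : good C.
  right; split=> //; first exact: slat_filter_principal.
  exact: lexx.
have [|P [goodP maxP]] := @Zorn_bigcup A good.
  move=> F sF totF; have [[G [FG [y Gy]]]|F0] :=
      pselect (exists G, F G /\ G !=set0); last first.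
    left; apply/seteqP; split=> // x [G FG Gx]; case: F0.
    by exists G; split=> //; exists x.
  have nonempty_good H x : F H -> H x -> [/\ slat_filter H, H c & ~ H a].
    by move=> /sF [->|//].
  have [fG Gc _] := nonempty_good _ _ FG Gy.
  right; split; last 2 first.
  + by exists G.
  + by move=> [H FH Ha]; have [_ _] := nonempty_good _ _ FH Ha; exact.
  split.
  + by exists G => //; exact: slat_filter_top.
  + move=> x z xz [H FH Hx]; exists H => //.
    have [fH _ _] := nonempty_good _ _ FH Hx.
    exact: (slat_filter_up fH xz).
  + move=> x z [H FH Hx] [H' FH' Hz].
    have [fH _ _] := nonempty_good _ _ FH Hx.
    have [fH' _ _] := nonempty_good _ _ FH' Hz.
    have [HH'|H'H] := totF _ _ FH FH'.
      by exists H' => //; apply: (slat_filter_meet fH') => //; exact: HH'.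
    by exists H => //; apply: (slat_filter_meet fH) => //; exact: H'H.
case: goodP => [P0|[fP Pc nPa]].
  (* The empty set is not maximal: the principal filter [C] is good and lies properly above it. *)
  case: (maxP C) => //; rewrite P0 properEneq; split => //.
  by apply/eqP => /seteqP[_ /(_ c)]; apply; exact: lexx.
have above G : slat_filter G -> G <> P -> P `<=` G -> G a.
  move=> fG GP PG; apply: contrapT => nGa; apply: (maxP G).
    by rewrite properEneq; split => //; apply/eqP => PG'; apply: GP.
  by right; split=> //; exact: PG.
exists P; split=> //; split=> //; first by move=> PT; apply: nPa; rewrite PT.
move=> [F1 [F2 [fF1 fF2 F1P F2P PF]]]; apply: nPa; rewrite PF; split.
- by apply: above => //; rewrite PF => x [].
- by apply: above => //; rewrite PF => x [].
Qed.

Lemma betaS a c : beta c `<=` beta a -> (c <= a)%O.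
Proof.
move=> ca; apply: contrapT => /irreducible_filter_separation[P [iP Pc nPa]].
exact: nPa (ca (SigSub (mem_set iP)) Pc).
Qed.

Lemma beta_meet a b : beta (Order.meet a b) = beta a `&` beta b.
Proof.
apply/seteqP; split=> P; rewrite /beta /setI /=;
  have [fP _ _] := set_mem (valP P).
- move=> Pab; split; apply: (slat_filter_up fP _ Pab).
    exact: leIl.
  exact: leIr.
- by move=> [Pa Pb]; exact: (slat_filter_meet fP).
Qed.

Lemma beta_top : beta (\top%O : A) = setT.
Proof.
apply/seteqP; split=> // P _; have [fP _ _] := set_mem (valP P).
exact: (slat_filter_top fP).
Qed.

Lemma Sfam_KA (V : set (XA A)) : Sfam (KA A) V <-> exists a, V = beta a.
Proof.
split=> [[_ [a _ <-] <-]|[a ->]]; first by exists a; rewrite setCK.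
by exists (~` beta a); [exists a | rewrite setCK].
Qed.

Lemma Zfam_KA a : Zfam (KA A) (~` beta a).
Proof.
exists [set ~` beta a]; last by rewrite bigcap_set1.
split; first by move=> _ ->; exists a.
split; first by exists (~` beta a).
by move=> _ _ -> ->; exists (~` beta a) => //; split.
Qed.

Variable m : A -> A.
Hypothesis m_homo : {homo m : a b / (a <= b)%O}.

(** By [betaS], [IA] of the complement of [beta a] is the down-set of [a]; as [m] is monotone, the
    preimage of [P] meets it exactly when [P] contains [m a]. *)
Lemma Rm_setC_beta (P : XA A) a : Rm m P (~` beta a) <-> ~ beta (m a) P.
Proof.
split=> [[_ mI] Pma|nPma].
  have : ((m @^-1` val P) `&` IA (~` beta a)) a.
    by split=> //; rewrite /IA /= setICr.
  by rewrite mI.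
split; first exact: Zfam_KA.
apply/seteqP; split=> // c [Pmc]; rewrite /IA /= => /disjoints_subset.
rewrite setCK => /betaS /m_homo mca; apply: nPma.
have [fP _ _] := set_mem (valP P).
exact: (slat_filter_up fP mca).
Qed.

Lemma mR_Rm_beta a : mR (Rm m) (beta a) = beta (m a).
Proof.
apply/seteqP; split=> P.
  move=> mP; apply: contrapT => /Rm_setC_beta /mP.
  by rewrite setICl => -[].
move=> Pma Z [_ mI]; apply: contrapT => /set0P/negP.
rewrite negbK => /eqP aZ; have : ((m @^-1` val P) `&` IA Z) a.
  by split=> //; rewrite /IA /= setIC.
by rewrite mI.
Qed.

End Filters.

(** * One-to-one meet-relations into the dual space *)

Section MeetRelation.
Context {d : Order.disp_t} {A : tMeetSemilatticeType d}.
Variables (X : choiceType) (K : set (set X)) (T : X -> set (XA A)).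
Hypotheses (SX : S_space K) (T_mr : meet_relation K (KA A) T).
Hypothesis T_inj : one_to_one K (KA A) T.

Lemma setC_boxT_beta a : K (~` boxT T (beta a)).
Proof.
have /(meet_rel_box T_mr)[U KU <-] : Sfam (KA A) (beta a).
  by apply/Sfam_KA; exists a.
by rewrite setCK.
Qed.

(** An empty [T x] would put [x] in every box, whereas one-to-oneness, applied to the complement of
    a member of [K] around [x], gives a box without [x]. *)
Lemma one_to_one_nonempty x : T x !=set0.
Proof.
have : (\bigcup_(U in K) U) x by rewrite (S1_cover SX).
case=> U KU Ux; have [||V [_ _ nxV]] := T_inj x (~` U).
- by exists U.
- by apply.
- apply: contrapT => Tx0; apply: nxV => y Txy; case: Tx0; by exists y.
Qed.

Lemma one_to_one_injective : injective T.
Proof.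
have TT x y : T x = T y -> forall U, K U -> U x -> U y.
  move=> Txy U KU Ux; apply: contrapT => nUy.
  have [||V [_ UV nxV]] := T_inj x (~` U); first by exists U.
    by apply.
  by apply: nxV; rewrite /boxT /= Txy; exact: (UV y).
move=> x y Txy; apply: (kolmogorov_subbase_separated _ _ _ _ (S1_T0 SX)) => U KU.
by split; apply: TT KU.
Qed.

(** One-to-oneness covers [U] by complements of boxes that contain the complement of [U]. Boxes turn
    meets into intersections, so this cover is directed and compactness leaves a single [a]. *)
Lemma compact_setC_boxT U : K U -> exists a, U = ~` boxT T (beta a).
Proof.
move=> KU; pose E : set A := [set a | ~` U `<=` boxT T (beta a)].
have [||||a Ea Ua] := @compact_directed_cover (subbase_space K) A E
  (fun a => ~` boxT T (beta a)) U (S2_compact SX KU).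
- by exists \top%O => x _; rewrite /boxT /= beta_top.
- move=> a b Ea Eb; exists (Order.meet a b).
    move=> x nUx; rewrite /boxT /= beta_meet subsetI.
    by split; [exact: Ea | exact: Eb].
  rewrite -setCI; apply: subsetC => x.
  by rewrite /boxT /= beta_meet subsetI.
- by move=> a _; apply: subbase_open; exact: setC_boxT_beta.
- move=> x Ux; have [||_ [/Sfam_KA[a ->] UV nxV]] := T_inj x (~` U).
  + by exists U.
  + by apply.
  + by exists a.
exists a; apply/seteqP; split=> // x nx; apply: contrapT => nUx.
by apply: nx; exact: Ea.
Qed.

End MeetRelation.

Theorem theorem18 (d : Order.disp_t) (A : tMeetSemilatticeType d) (m : A -> A)
    (m_homo : {homo m : a b / (a <= b)%O})
    (X : choiceType) (K : set (set X)) (R : X -> set (set X))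
    (XKR : mS_space K R) (T : X -> set (XA A))
    (T_mmr : monotone_meet_relation K (KA A) R (Rm m) T)
    (T_inj : one_to_one K (KA A) T) :
  monotone_lower_Vietoris (KA A) (Rm m) [set T x | x in setT].
Proof.
have SX := mS_S_space XKR; have [T_mr T_mono] := T_mmr.
set F := [set T x | x in setT].
have FT x : F (T x) by exists x.
pose f x : F := SigSub (mem_set (FT x)).
(* [g] picks a point for each member of [F]; injectivity of [T] will make it the inverse of [f]. *)
have /choice[g gT] (Y : F) : exists x, T x = val Y.
  by have [x _ xY] := set_mem (valP Y); exists x.
have hitE x a : @hit _ F (~` beta a) (f x) <-> ~ boxT T (beta a) x.
  rewrite /hit /=; split=> [[y [Ty nay]] /(_ y Ty)//|/existsNP[y]].
  by move=> /not_implyP[Ty nay]; exists y.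
split.
- by move=> _ [x _ <-]; exact: one_to_one_nonempty _ _ _ SX T_inj x.
- move=> _ [x _ <-]; rewrite (meet_rel_section T_mr x).
  by exists [set U | Sfam (KA A) U /\ T x `<=` U] => // U [].
- have fK : cancel f g.
    move=> x; apply: (one_to_one_injective _ _ _ SX T_inj).
    exact: gT.
  have gK : cancel g f by move=> Y; apply: val_inj; exact: gT.
  apply: (S_space_transport _ _ _ _ _ _ fK gK _ SX) => V; split.
    move=> [_ [a _ <-] <-].
    have -> : f @^-1` @hit _ F (~` beta a) = ~` boxT T (beta a).
      by apply/seteqP; split=> x /hitE.
    exact: setC_boxT_beta.
  move=> /(compact_setC_boxT _ _ _ SX T_mr T_inj)[a fV].
  exists (~` beta a); first by exists a.
  (* Writing [Y] as [f (g Y)] makes [hitE] applicable to an arbitrary member of [F]. *)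
  apply/seteqP; split=> Y; rewrite -(gK Y).
    by move=> /hitE; rewrite -[~ _]/((~` boxT T (beta a)) (g Y)) -fV.
  by move=> VY; apply/hitE; rewrite -[~ _]/((~` boxT T (beta a)) (g Y)) -fV.
- move=> _ [x _ <-]; apply/seteqP; split; last first.
    by move=> V [HV KV]; split=> //; exists V.
  move=> _ [[b _ <-] [U [[y Txy Ry] [a _ aU]] sab]]; split; last by exists b.
  rewrite -{U}aU in Ry sab.
  (* Traces are complements of boxes, so their inclusion reverses on the boxes. *)
  have boxS : boxT T (beta b) `<=` boxT T (beta a).
    by move=> z zb; apply: contrapT => /hitE/sab/hitE.
  have boxm c : boxT T (beta (m c)) = mR R (boxT T (beta c)).
    by rewrite T_mono ?mR_Rm_beta//; apply/Sfam_KA; exists c.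
  (* Otherwise [x] lies in the box of [beta (m b)], hence in that of [beta (m a)] since [mR] is
     monotone; then [y] contains [m a], against [Ry]. *)
  have /existsNP[z /not_implyP[Txz nz]] : ~ boxT T (beta (m b)) x.
    rewrite boxm => mb; have : boxT T (beta (m a)) x.
      by rewrite boxm => Z /mb [w [Zw /boxS]]; exists w.
    by move=> /(_ y Txy); move/Rm_setC_beta : Ry; exact.
  by exists z => //; exact/Rm_setC_beta.
Qed.
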